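(* Let $\pi$ be any probability measure on the parameter space $\Theta=\mathbb{R}^m$, let $\mathrm{Aggr}(\cdot)$ be an aggregation rule with aggregated gradient map $\widehat g_{\mathrm{Aggr}}:\Theta\to\Theta$ (which depends on the sampled target dataset $\widehat{\mathcal D}_T$), and let $\mu>0$ be a step size. Given $\widehat{\mathcal D}_T$, update the parameter for $T$ steps, starting from an initial $\theta^0\in\Theta$, by $$\theta^{t+1}:=\theta^t-\mu\,\widehat g_{\mathrm{Aggr}}(\theta^t).$$ Assume that the gradient $\nabla\ell(\theta,z)$ and $\widehat g_{\mathrm{Aggr}}(\theta)$ are $\tfrac{\gamma}{2}$-Lipschitz in $\theta$, and that $\theta^t\to\widehat\theta_{\mathrm{Aggr}}$ as $t\to\infty$ for some limit $\widehat\theta_{\mathrm{Aggr}}\in\Theta$ (depending on $\widehat{\mathcal D}_T$). Then, given step size $\mu\le \tfrac1\gamma$ and a small enough $\epsilon>0$, with probability at least $1-\delta$ (over the draw of $\widehat{\mathcal D}_T$) we have $$\|\nabla\ell_{\mathcal D_T}(\theta^T)\|^2\le \frac{1}{\delta^2}\left(\sqrt{C_\epsilon\cdot\Delta^2_{\mathrm{Aggr}}}+\mathcal O(\epsilon)\right)^2+\mathcal O\!\left(\frac1T\right)+\mathcal O(\epsilon),$$ where $$C_\epsilon=\mathbb{E}_{\widehat{\mathcal D}_T}\left[\left(\frac{1}{\pi(B_\epsilon(\widehat\theta_{\mathrm{Aggr}}))}\right)^2\right]$$ and $B_\epsilon(\widehat\theta_{\mathrm{Aggr}})\subset\mathbb{R}^m$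 is the ball of radius $\epsilon$ centered at $\widehat\theta_{\mathrm{Aggr}}$.
   Context: Setting. $\mathcal Z$ is a ground set of data points, $\Theta=\mathbb{R}^m$ is the parameter space with Euclidean inner product $\langle\cdot,\cdot\rangle$ and norm $\|\cdot\|$, and $\ell:\Theta\times\mathcal Z\to\mathbb{R}_+$ is a nonnegative loss, differentiable in $\theta$; $\nabla$ denotes the gradient in $\theta$. For a distribution $\mathcal D$ on $\mathcal Z$, $\ell_{\mathcal D}(\theta):=\mathbb{E}_{z\sim\mathcal D}\,\ell(\theta,z)$ and $g_{\mathcal D}(\theta):=\nabla\ell_{\mathcal D}(\theta)$; for a finite dataset $\widehat{\mathcal D}$, $\ell_{\widehat{\mathcal D}}(\theta):=\frac{1}{|\widehat{\mathcal D}|}\sum_{z\in\widehat{\mathcal D}}\ell(\theta,z)$ and $g_{\widehat{\mathcal D}}:=\nabla\ell_{\widehat{\mathcal D}}$. There are $N$ source domains (distributions) $\mathcal D_{S_1},\dots,\mathcal D_{S_N}$, treated as fixed, and a target domain $\mathcal D_T$. The target dataset $\widehat{\mathcal D}_T=\{z_1,\dots,z_n\}$ consists of $n$ i.i.d. samples from $\mathcal D_T$; in particular $\mathbb{E}_{\widehat{\mathcal D}_T}[g_{\widehat{\mathcal D}_T}]=g_{\mathcal D_T}$. $\mathbb{E}_{\widehat{\mathcal D}_T}$ denotes expectation over the draw of this dataset. An aggregation rule $\mathrm{Aggr}$ maps the source gradients and the empirical target gradient to an update direction: $\widehat g_{\mathrm{Aggr}}(\theta)=\mathrm{Aggr}(\{g_{\mathcal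 D_{S_i}}(\theta)\}_{i=1}^N,\,g_{\widehat{\mathcal D}_T}(\theta))$. For a probability measure $\pi$ on $\Theta$ and $g:\Theta\to\Theta$, $\|g\|_\pi:=\sqrt{\mathbb{E}_{\theta\sim\pi}\|g(\theta)\|^2}$. The Delta error of the aggregation rule is $\Delta^2_{\mathrm{Aggr}}:=\mathbb{E}_{\widehat{\mathcal D}_T}\|g_{\mathcal D_T}-\widehat g_{\mathrm{Aggr}}\|_\pi^2$. Conventions for the asymptotic notation: $\mathcal O(1/T)$ is as $T\to\infty$, with an implied constant that does not depend on $T$ but may depend on $\epsilon$, $\delta$, $\theta^0$ and the realized dataset $\widehat{\mathcal D}_T$; $\mathcal O(\epsilon)$ is as $\epsilon\to0$, with implied constants that do not depend on $\epsilon$ or $T$ (the one inside the parentheses depends only on $\gamma$; the last one may depend on the problem constants, on $\delta$ and on the realized dataset). If $C_\epsilon=+\infty$, the bound is understood as vacuous. *)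

(* Defs.v *)
From mathcomp Require Import all_boot all_order all_algebra.
From mathcomp Require Import all_classical all_reals all_analysis.

Set Implicit Arguments.
Unset Strict Implicit.
Unset Printing Implicit Defensive.

Import Order.TTheory GRing.Theory Num.Theory.
Import numFieldNormedType.Exports.

Local Open Scope classical_set_scope.
Local Open Scope ring_scope.

(* The library norm on 'rV[R]_m is the sup norm, hence the explicit Euclidean
   norm and ball below.  The two norms induce the same topology, so that
   convergence, differentiability and Borel sets are the library's. *)
Definition enorm (R : realType) (m : nat) (v : 'rV[R]_m) : R :=
  Num.sqrt (\sum_(i < m) v 0 i ^+ 2).

Definition eball (R : realType) (m : nat) (c : 'rV[R]_m) (r : R) :
  set 'rV[R]_m := [set x | enorm (x - c) < r].

Definition elipschitz (R : realType) (m : nat) (k : R)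
    (f : 'rV[R]_m -> 'rV[R]_m) : Prop :=
  forall x y, enorm (f x - f y) <= k * enorm (x - y).

Definition grad (R : realType) (m : nat) (f : 'rV[R]_m -> R) (x : 'rV[R]_m) :
  'rV[R]_m := \row_(i < m) 'D_(delta_mx 0 i) f x.

Definition borel_rV (R : realType) (m : nat) :=
  g_sigma_algebraType (@open 'rV[R]_m).

Section learning.
Context (R : realType) (m n N : nat) (d : measure_display)
  (Z : measurableType d).
Implicit Types (l : 'rV[R]_m -> Z -> R) (D : probability Z R)
  (S : n.-tuple Z) (P : probability (n.-tuple Z) R)
  (pi : probability (borel_rV R m) R).

Definition risk l D (theta : 'rV[R]_m) : R :=
  Rintegral D [set: Z] (l theta).

Definition finite_risk l D : Prop :=
  forall theta, D.-integrable [set: Z] (EFin \o l theta).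

Definition empirical_risk l S (theta : 'rV[R]_m) : R :=
  n%:R^-1 * \sum_(i < n) l theta (tnth S i).

(* P is the law of n i.i.d. samples from D, i.e. the n-fold product measure,
   which is determined by its values on measurable boxes. *)
Definition iid_law D P : Prop :=
  forall A : 'I_n -> set Z, (forall i, measurable (A i)) ->
    P [set S | forall i, A i (tnth S i)] = (\prod_(i < n) D (A i))%E.

Definition aggr_grad l (DS : 'I_N -> probability Z R)
    (Aggr : ('I_N -> 'rV[R]_m) -> 'rV[R]_m -> 'rV[R]_m) S
    (theta : 'rV[R]_m) : 'rV[R]_m :=
  Aggr (fun i => grad (risk l (DS i)) theta) (grad (empirical_risk l S) theta).

Definition gd_iter (mu : R) (g : 'rV[R]_m -> 'rV[R]_m) (theta0 : 'rV[R]_m)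
    (t : nat) : 'rV[R]_m :=
  iter t (fun theta => theta - mu *: g theta) theta0.

Definition norm_pi pi (g : 'rV[R]_m -> 'rV[R]_m) : \bar R :=
  sqrte (\int[pi]_theta ((enorm (g theta)) ^+ 2)%:E)%E.

Definition delta_error2 pi P (g : 'rV[R]_m -> 'rV[R]_m)
    (ghat : n.-tuple Z -> 'rV[R]_m -> 'rV[R]_m) : \bar R :=
  (\int[P]_S (norm_pi pi (fun theta => (g theta - ghat S theta)%R)) ^+ 2)%E.

(* The inverse is that of \bar R, with 0^-1 = +oo. *)
Definition C_eps pi P (theta_hat : n.-tuple Z -> 'rV[R]_m) (eps : R) :
  \bar R :=
  (\int[P]_S ((pi (eball (theta_hat S) eps))^-1) ^+ 2)%E.

End learning.

(* Main.v *)
Require Import Defs.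
From mathcomp Require Import all_boot all_order all_algebra.
From mathcomp Require Import all_classical all_reals all_analysis.
From mathcomp Require Import measurable_realfun ring lra.
Import Order.TTheory GRing.Theory Num.Theory.
Import numFieldNormedType.Exports.
Local Open Scope classical_set_scope.
Local Open Scope ring_scope.

(* The limit theta_hat is a zero of the aggregated gradient, so the error field
   f = g_DT - ghat, which is gamma-Lipschitz, takes the value g_DT(theta_hat)
   there.  Integrating |f(theta_hat)| <= |f(theta)| + gamma eps over the ball B
   of radius eps gives |g_DT(theta_hat)| <= |f|_pi / pi(B) + gamma eps.
   Cauchy-Schwarz over the draw of the dataset bounds the mean of the right-hand
   side by sqrt(C_eps Delta^2) + gamma eps, and Markov's inequality turns this
   into a bound with probability 1 - delta.  Convergence of the iterates carries
   the bound from theta_hat to theta^T: all but finitely many T cost at most eps,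
   and since the constant of O(1/T) may depend on eps and on the dataset, it
   absorbs the remaining ones, whatever the rate of convergence. *)

(** * The Euclidean norm and its comparison with the sup norm *)

Lemma enorm_ge0 {R : realType} {m : nat} (v : 'rV[R]_m) : 0 <= enorm v.
Proof. exact: sqrtr_ge0. Qed.

Lemma sqr_enorm {R : realType} {m : nat} (v : 'rV[R]_m) :
  enorm v ^+ 2 = \sum_(i < m) v 0 i ^+ 2.
Proof. by rewrite sqr_sqrtr// sumr_ge0// => i _; rewrite sqr_ge0. Qed.

Lemma enormN {R : realType} {m : nat} (v : 'rV[R]_m) : enorm (- v) = enorm v.
Proof. by congr Num.sqrt; apply: eq_bigr => i _; rewrite mxE sqrrN. Qed.

Lemma enorm_distC {R : realType} {m : nat} (u v : 'rV[R]_m) :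
  enorm (u - v) = enorm (v - u).
Proof. by rewrite -enormN opprB. Qed.

Lemma normr_coord_le_enorm {R : realType} {m : nat} (v : 'rV[R]_m) i :
  `|v 0 i| <= enorm v.
Proof.
rewrite -sqrtr_sqr ler_sqrt ?sumr_ge0// => [|j _]; rewrite ?sqr_ge0//.
by rewrite (bigD1 i)//= lerDl sumr_ge0// => j _; rewrite sqr_ge0.
Qed.

(** Cauchy-Schwarz from a discriminant-free identity: with c the inner product, the squared norm of
    |v|^2 u - c v equals |v|^2 (|u|^2 |v|^2 - c^2). It remains to divide by |v|^2, the case |v| = 0
    being apart. *)
Lemma dot_le_enorm {R : realType} {m : nat} (u v : 'rV[R]_m) :
  \sum_(i < m) u 0 i * v 0 i <= enorm u * enorm v.
Proof.
have sumE b e : \sum_(i < m) (b * u 0 i - e * v 0 i) ^+ 2 = b ^+ 2 * enorm u ^+ 2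
    - 2 * b * e * (\sum_(i < m) u 0 i * v 0 i) + e ^+ 2 * enorm v ^+ 2.
  rewrite !sqr_enorm !mulr_sumr -sumrB -big_split/=.
  by apply: eq_bigr => i _; ring.
set c := \sum_(i < m) _ in sumE *.
have [c0|c0] := ltP c 0.
  by rewrite (le_trans (ltW c0))// mulr_ge0// enorm_ge0.
have B0 := enorm_ge0 v; have A0 := enorm_ge0 u.
have h0 : 0 <= \sum_(i < m) (enorm v ^+ 2 * u 0 i - c * v 0 i) ^+ 2.
  by apply: sumr_ge0 => i _; rewrite sqr_ge0.
rewrite sumE in h0.
move: B0; rewrite le_eqVlt => /predU1P[v0|v0].
  suff -> : c = 0 by rewrite -v0 mulr0.
  rewrite /c big1// => i _.
  have := normr_coord_le_enorm v i; rewrite -v0 normr_le0 => /eqP ->.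
  by rewrite mulr0.
rewrite -(@ler_pXn2r _ 2)// ?nnegrE ?mulr_ge0//; last exact: ltW.
rewrite exprMn -subr_ge0 -(pmulr_rge0 _ (exprn_gt0 2 v0)).
by apply: le_trans h0 _; rewrite le_eqVlt; apply/orP; left; apply/eqP; ring.
Qed.

Lemma normr_dot_le_enorm {R : realType} {m : nat} (u v : 'rV[R]_m) :
  `|\sum_(i < m) u 0 i * v 0 i| <= enorm u * enorm v.
Proof.
rewrite ler_norml dot_le_enorm andbT lerNl -[enorm u]enormN -sumrN.
rewrite (le_trans _ (dot_le_enorm _ _))// ler_sum// => i _.
by rewrite mxE mulNr.
Qed.

Lemma ler_enormD {R : realType} {m : nat} (u v : 'rV[R]_m) :
  enorm (u + v) <= enorm u + enorm v.
Proof.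
rewrite -(@ler_pXn2r _ 2)// ?nnegrE ?addr_ge0 ?enorm_ge0// sqrrD !sqr_enorm.
have -> : \sum_(i < m) (u + v) 0 i ^+ 2 = \sum_(i < m) u 0 i ^+ 2 +
    (\sum_(i < m) u 0 i * v 0 i) *+ 2 + \sum_(i < m) v 0 i ^+ 2.
  rewrite -sumrMnl -!big_split/=; apply: eq_bigr => i _.
  by rewrite mxE sqrrD.
by rewrite lerD2r lerD2l lerMn2r dot_le_enorm orbT.
Qed.

Lemma enormZ {R : realType} {m : nat} (c : R) (v : 'rV[R]_m) :
  enorm (c *: v) = `|c| * enorm v.
Proof.
rewrite /enorm -sqrtr_sqr -sqrtrM ?sqr_ge0//; congr Num.sqrt.
by rewrite mulr_sumr; apply: eq_bigr => i _; rewrite mxE exprMn.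
Qed.

Lemma ler_dist_enorm {R : realType} {m : nat} (u v : 'rV[R]_m) :
  `|enorm u - enorm v| <= enorm (u - v).
Proof.
rewrite ler_norml lerBlDr lerNl opprB lerBlDr [enorm (u - v)]enorm_distC.
have := ler_enormD (v - u) u; rewrite subrK => ->.
by have := ler_enormD (u - v) v; rewrite subrK [enorm (u - v)]enorm_distC.
Qed.

Lemma enorm_distD {R : realType} {m : nat} (w u v : 'rV[R]_m) :
  enorm (u - v) <= enorm (u - w) + enorm (w - v).
Proof. by rewrite (le_trans _ (ler_enormD _ _))// addrA subrK. Qed.

Lemma enorm_le_sum {R : realType} {m : nat} (v : 'rV[R]_m) :
  enorm v <= \sum_(i < m) `|v 0 i|.
Proof.
have s0 : 0 <= \sum_(i < m) `|v 0 i| by exact: sumr_ge0.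
rewrite -(@ler_pXn2r _ 2)// ?nnegrE ?enorm_ge0// sqr_enorm.
rewrite [leRHS]expr2 mulr_suml ler_sum// => i _.
rewrite -real_normK ?num_real// expr2 ler_wpM2l//.
by rewrite (bigD1 i)//= lerDl sumr_ge0.
Qed.

(** Transfers convergence in the library's sup norm to the Euclidean norm; the size of the factor is
    immaterial. *)
Lemma enorm_le_norm {R : realType} {m : nat} (v : 'rV[R]_m) :
  enorm v <= m%:R * `|v|.
Proof.
apply: le_trans (enorm_le_sum v) _.
rewrite -[X in X%:R](card_ord m) -sum1_card natr_sum mulr_suml ler_sum// => i _.
by rewrite mul1r [leRHS]mx_normrE (le_bigmax _ (fun ij => `|v ij.1 ij.2|) (0, i)).
Qed.

Lemma cvg_enorm {R : realType} {m : nat} {I : Type} (F : set_system I)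
    {FF : Filter F} (u : I -> 'rV[R]_m) (l : 'rV[R]_m) :
  u @ F --> l -> enorm (u t - l) @[t --> F] --> (0 : R).
Proof.
move=> ul; apply: (@squeeze_cvgr _ _ _ _ (fun=> 0) (fun t => m%:R * `|u t - l|)).
- by near=> t; rewrite enorm_ge0 enorm_le_norm.
- exact: cvg_cst.
- rewrite -[X in _ --> X](mulr0 m%:R); apply: cvgMr.
  by rewrite -[X in _ --> X](normr0 'rV[R]_m); apply: cvg_norm; exact/subr_cvg0.
Unshelve. all: by end_near. Qed.

Lemma elipschitz_coord {R : realType} {m : nat} (k : R) (f : 'rV[R]_m -> 'rV[R]_m) i x y :
  elipschitz k f -> `|f x 0 i - f y 0 i| <= k * enorm (x - y).
Proof.
move=> /(_ x y); apply: le_trans.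
by have := normr_coord_le_enorm (f x - f y) i; rewrite !mxE.
Qed.

(** * Borel measurability of balls, norms and Lipschitz families *)

Lemma open_eball {R : realType} {m : nat} (c : 'rV[R]_m) (r : R) :
  open (eball c r).
Proof.
rewrite openE => x xr; rewrite /interior.
have xx : (id : 'rV[R]_m -> 'rV[R]_m) @ x --> x by exact: cvg_id.
have e0 : 0 < r - enorm (x - c) by rewrite subr_gt0.
have h0 : enorm (y - x) @[y --> x] --> (0 : R) by exact: cvg_enorm xx.
have hlt := cvgr0_norm_lt _ h0 _ e0.
move: (hlt (nbhs_filter x)); apply: filterS => y.
rewrite ger0_norm ?enorm_ge0// /eball/= => h.
by rewrite (le_lt_trans (enorm_distD x _ _))// -ltrBrDr.
Qed.

Lemma measurable_coord {R : realType} {m : nat} (i : 'I_m) :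
  measurable_fun [set: borel_rV R m] (fun x : borel_rV R m => (x : 'rV[R]_m) 0 i).
Proof.
apply: (measurability _ (RGenOpens.measurableE R)).
move=> _ [_ [a [b ->] <-]]; rewrite setTI; apply: sub_sigma_algebra.
have /continuousP := @coord_continuous R 1 m 0 i.
by apply; exact: interval_open.
Qed.

Lemma measurable_eball {R : realType} {m : nat} (c : 'rV[R]_m) (r : R) :
  measurable (eball c r : set (borel_rV R m)).
Proof. by apply: sub_sigma_algebra; exact: open_eball. Qed.

Lemma measurable_enorm {R : realType} {m : nat} {d} {W : measurableType d}
    (X : W -> 'rV[R]_m) :
  (forall i, measurable_fun [set: W] (fun w => X w 0 i)) ->
  measurable_fun [set: W] (fun w => enorm (X w)).
Proof.
move=> mX; apply: (@measurableT_comp _ _ _ _ _ _ (@Num.sqrt R)).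
  by apply: continuous_measurable_fun; exact: sqrt_continuous.
apply: measurable_sum => i; exact: measurable_funX.
Qed.

Lemma exists_rat_enorm_lt {R : realType} {m : nat} (x : 'rV[R]_m) (e : R) : 0 < e ->
  exists q : 'rV[rat]_m, enorm (x - map_mx ratr q) < e.
Proof.
(* With m + 1 instead of m, the division makes sense for m = 0 and the m coordinate errors add up to
   strictly less than [e]. *)
move=> e0; have M0 : 0 < m.+1%:R :> R by [].
have h i : exists q : rat, `|x 0 i - ratr q| < e / m.+1%:R.
  have : x 0 i - e / m.+1%:R < x 0 i + e / m.+1%:R.
    by rewrite ltrD2l gtrN// divr_gt0.
  move=> /rat_in_itvoo[q]; rewrite in_itv/= => /andP[q1 q2].
  by exists q; rewrite distrC ltr_distl q1.
have [q hq] := choice h.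
exists (\row_i q i); rewrite (le_lt_trans (enorm_le_sum _))//.
apply: (@le_lt_trans _ _ (\sum_(i < m) e / m.+1%:R)).
  by apply: ler_sum => i _; rewrite !mxE ltW.
rewrite sumr_const card_ord -[ltLHS]mulr_natr mulrAC ltr_pdivrMr//.
by rewrite ltr_pM2l// ltr_nat.
Qed.

(* For each [w], [f w (X w)] is the infimum of [f w q + k * enorm (X w - q)]
   over the rational vectors [q]. *)
Lemma measurable_lipschitz_comp {R : realType} {m : nat} {d} {W : measurableType d}
    (k : R) (f : W -> 'rV[R]_m -> R) (X : W -> 'rV[R]_m) : 0 <= k ->
  (forall w x y, `|f w x - f w y| <= k * enorm (x - y)) ->
  (forall x, measurable_fun [set: W] (f ^~ x)) ->
  (forall i, measurable_fun [set: W] (fun w => X w 0 i)) ->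
  measurable_fun [set: W] (fun w => f w (X w)).
Proof.
move=> k0 lipf mf mX; apply: (measurability _ (RGenInftyO.measurableE R)).
move=> _ [_ [a ->] <-]; rewrite setTI.
pose g (q : 'rV[rat]_m) w := f w (map_mx ratr q) + k * enorm (X w - map_mx ratr q).
have -> : (fun w => f w (X w)) @^-1` `]-oo, a[%classic =
    \bigcup_(q in [set: 'rV[rat]_m]) (g q @^-1` `]-oo, a[%classic).
  apply/seteqP; split=> w /=; rewrite ?in_itv/=.
    (* A rational q at distance E from [X w] gives at most [f w (X w)] + 2kE, so E < e suffices for
       a value below [a]; the + 1 covers k = 0. *)
    move=> fa; have e0 : 0 < (a - f w (X w)) / (2 * k + 1).
      by rewrite divr_gt0 ?subr_gt0//; lra.
    have [q qe] := exists_rat_enorm_lt (X w) _ e0.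
    exists q => //=; rewrite in_itv/= /g.
    have := lipf w (X w) (map_mx ratr q).
    rewrite ler_distlC => /andP[_ h]; rewrite (le_lt_trans (lerD h (lexx _)))//.
    rewrite ltr_pdivlMr in qe; last lra.
    have := enorm_ge0 (X w - map_mx ratr q).
    move: qe; set E := enorm _ => qe E0.
    have [->|kE] := eqVneq E 0; first by rewrite mulr0 !addr0.
    have : 0 < E by rewrite lt0r kE.
    by nra.
  move=> [q _] /=; rewrite in_itv/=; apply: le_lt_trans.
  have := lipf w (X w) (map_mx ratr q).
  by rewrite ler_distlC => /andP[h _]; rewrite /g -lerBlDr.
apply: countable_bigcupT_measurable => // q.
rewrite -[_ @^-1` _]setTI.
apply: (_ : measurable_fun setT (g q)) => //.
apply: measurable_funD; first exact: mf.
apply: measurable_funM; first exact: measurable_cst.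
apply: measurable_enorm => i.
under eq_fun do rewrite mxE.
by apply: measurable_funD => //; exact: measurable_cst.
Qed.

(** * Differentiation under the integral sign *)

Lemma enorm_delta {R : realType} {m : nat} (i : 'I_m) (h : R) :
  enorm (h *: delta_mx 0 i) = `|h|.
Proof.
rewrite -sqrtr_sqr; congr Num.sqrt; rewrite (bigD1 i)//= !mxE !eqxx mulr1.
by rewrite big1 ?addr0// => j /negbTE ji; rewrite !mxE ji andbF mulr0 expr0n.
Qed.

(** By the mean value theorem the increment is h df(c) with |c| <= |h|, and the Lipschitz condition
    at 0 compares df(c) with df(0). *)
Lemma taylor1_bound {R : realType} (k : R) (f df : R -> R) :
  (forall s : R, is_derive s 1 f (df s)) ->
  (forall s, `|df s - df 0| <= k * `|s|) ->
  forall h, `|f h - f 0 - h * df 0| <= k * h ^+ 2.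
Proof.
move=> dfP lip h.
have cf (a b : R) : {within `[a, b], continuous f}.
  by apply: derivable_within_continuous => s _; have [] := dfP s.
suff [c ch ->] : exists2 c, `|c| <= `|h| & f h - f 0 = df c * h.
  rewrite mulrC -mulrBr normrM mulrC -real_normK ?num_real// expr2 mulrA.
  have k0 : 0 <= k.
    by have := le_trans (normr_ge0 _) (lip 1); rewrite normr1 mulr1.
  by rewrite ler_wpM2r// (le_trans (lip c))// ler_wpM2l.
have [h0|/ltW h0] := leP 0 h.
  have [c] := @MVT_segment _ f df _ _ h0 (fun s _ => dfP s) (cf _ _).
  rewrite in_itv/= subr0 => /andP[c0 ch ->]; exists c => //.
  by rewrite !ger0_norm// (le_trans c0).
have [c] := @MVT_segment _ f df _ _ h0 (fun s _ => dfP s) (cf _ _).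
rewrite in_itv/= sub0r => /andP[ch c0 h']; exists c.
  by rewrite !ler0_norm// lerN2.
by rewrite -opprB h' mulrN opprK.
Qed.

(** Apply [taylor1_bound] along the i-th axis. The remainder depends on k and h only; for a loss
    this makes it uniform in the data point, which gives measurability and integrability of the
    gradient and its exchange with the integral. *)
Lemma grad_taylor {R : realType} {m : nat} (k : R) (f : 'rV[R]_m -> R) x i h :
  (forall y, differentiable f y) -> elipschitz k (grad f) ->
  `|f (x + h *: delta_mx 0 i) - f x - h * grad f x 0 i| <= k * h ^+ 2.
Proof.
move=> df lip.
pose phi s := f (x + s *: delta_mx 0 i).
pose dphi s := grad f (x + s *: delta_mx 0 i) 0 i.
have phi0 : x + 0 *: delta_mx 0 i = x by rewrite scale0r addr0.
(* Identifies the difference quotients of [phi] with those of [f] in direction i, so that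
   derivability and the derivative carry over. *)
have E (s : R) : (fun h : R => h^-1 *: (phi (h *: (1 : R^o) + s) - phi s)) =
    (fun h : R => h^-1 *: (f (h *: delta_mx 0 i + (x + s *: delta_mx 0 i)) -
       f (x + s *: delta_mx 0 i))).
  apply/funext => t; rewrite /phi [t *: _]mulr1 scalerDl.
  by rewrite addrCA.
have dphiP (s : R) : is_derive s 1 phi (dphi s).
  split.
    rewrite /derivable; rewrite [X in X @ _](E s).
    exact: diff_derivable.
  by rewrite /derive [X in X @ _](E s) /dphi /grad mxE.
rewrite -[in f x]phi0 -[in grad f x]phi0.
apply: (taylor1_bound k phi dphi dphiP) => s.
rewrite /dphi phi0; apply: le_trans (elipschitz_coord _ _ _ _ _ lip) _.
by rewrite addrAC subrr add0r enorm_delta.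
Qed.

(** The partial derivative is the pointwise limit of the measurable difference quotients with step
    1/(n+1). *)
Lemma measurable_grad {R : realType} {m : nat} {d} {Z : measurableType d}
    (k : R) (l : 'rV[R]_m -> Z -> R) theta i :
  (forall x, measurable_fun [set: Z] (l x)) ->
  (forall x z, differentiable (l ^~ z) x) ->
  (forall z, elipschitz k (grad (l ^~ z))) ->
  measurable_fun [set: Z] (fun z => grad (l ^~ z) theta 0 i).
Proof.
move=> ml dl lip.
pose h (n : nat) z := n.+1%:R * (l (theta + n.+1%:R^-1 *: delta_mx 0 i) z - l theta z).
apply: (@measurable_fun_cvg _ _ _ _ h).
  by move=> n; apply: measurable_funM => //; exact: measurable_funB.
move=> z _; apply/subr_cvg0.
apply/norm_cvg0P.
apply: (@squeeze_cvgr _ _ _ _ (fun=> 0) (fun n => k * n.+1%:R^-1)).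
- apply: nearW => n; rewrite normr_ge0/=.
  have n0 : 0 < n.+1%:R :> R by [].
  have := grad_taylor k (l ^~ z) theta i n.+1%:R^-1 (dl ^~ z) (lip z).
  set a := l _ z; set b := l _ z; set c := grad _ _ _ _ => H.
  have -> : h n z - c = n.+1%:R * (a - b - n.+1%:R^-1 * c).
    by rewrite /h [RHS]mulrBr mulVKf ?gt_eqF.
  rewrite normrM gtr0_norm// (le_trans (ler_wpM2l (ltW n0) H))//.
  by rewrite expr2 mulrCA mulVKf ?gt_eqF.
- exact: cvg_cst.
- rewrite -[X in _ --> X](mulr0 k); apply: cvgMr; exact: cvg_harmonic.
Qed.

(** The Taylor bound with step h = 1 dominates the partial derivative by |l(theta + e_i) - l(theta)|
    + k, which is integrable. *)
Lemma integrable_grad {R : realType} {m : nat} {d} {Z : measurableType d}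
    (k : R) (l : 'rV[R]_m -> Z -> R) (D : probability Z R) theta i :
  finite_risk l D ->
  (forall x z, differentiable (l ^~ z) x) ->
  (forall z, elipschitz k (grad (l ^~ z))) ->
  D.-integrable [set: Z] (EFin \o (fun z => grad (l ^~ z) theta 0 i)).
Proof.
move=> intl dl lip.
have ml x : measurable_fun [set: Z] (l x).
  by apply/measurable_EFinP; have /integrableP[] := intl x.
pose F z := l (theta + 1 *: delta_mx 0 i) z - l theta z.
have intF : D.-integrable [set: Z] (EFin \o F).
  by apply: (integrableB _ (intl _) (intl _)).
have intk : D.-integrable [set: Z] (EFin \o cst k).
  by apply: finite_measure_integrable_cst.
have intg : D.-integrable [set: Z] (EFin \o (fun z => `|F z| + k)).
  exact: (integrableD _ (integrable_abse intF) intk).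
apply: (le_integrable measurableT _ _ intg).
  by apply/measurable_EFinP; exact: measurable_grad ml dl lip.
move=> z _; rewrite /= lee_fin.
have := grad_taylor k (l ^~ z) theta i 1 (dl ^~ z) (lip z).
rewrite expr1n mulr1 mul1r -/(F z) => H.
have -> : grad (l ^~ z) theta 0 i = F z - (F z - grad (l ^~ z) theta 0 i) by ring.
rewrite (le_trans (ler_normB _ _))// (le_trans _ (ler_norm _))//.
by rewrite lerD2l.
Qed.

Lemma normr_Rintegral_le {R : realType} {d} {Z : measurableType d}
    (D : probability Z R) (f : Z -> R) (c : R) :
  D.-integrable [set: Z] (EFin \o f) -> (forall z, `|f z| <= c) ->
  `|Rintegral D [set: Z] f| <= c.
Proof.
move=> intf fc; apply: (le_trans (le_normr_Rintegral measurableT intf)).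
rewrite -[leRHS]mulr1 -[X in _ * X]/(fine 1%E) -(probability_setT D) -Rintegral_cst//.
apply: le_Rintegral => //; first exact: integrable_abse intf.
by apply: finite_measure_integrable_cst.
Qed.

Lemma grad_risk {R : realType} {m : nat} {d} {Z : measurableType d}
    (k : R) (l : 'rV[R]_m -> Z -> R) (D : probability Z R) theta i :
  finite_risk l D ->
  (forall x z, differentiable (l ^~ z) x) ->
  (forall z, elipschitz k (grad (l ^~ z))) ->
  grad (risk l D) theta 0 i = Rintegral D [set: Z] (fun z => grad (l ^~ z) theta 0 i).
Proof.
move=> intl dl lip; rewrite mxE; set c := Rintegral _ _ _.
have intG := integrable_grad _ _ _ theta i intl dl lip.
(* Integrating the uniform Taylor remainder against a probability preserves the bound k h^2;
   dividing by h then yields the derivative, with no dominated convergence. *)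
suff H h : `|risk l D (theta + h *: delta_mx 0 i) - risk l D theta - h * c| <= k * h ^+ 2.
  rewrite /derive; apply/cvg_lim => //; apply/subr_cvg0/norm_cvg0P.
  apply: (@squeeze_cvgr _ _ _ _ (fun=> 0) (fun h => k * `|h|)).
  - near=> h; rewrite normr_ge0/=.
    have h0 : h != 0 by near: h; exact: nbhs_dnbhs_neq.
    have nh0 : 0 < `|h| by rewrite normr_gt0.
    rewrite -(ler_pM2l nh0) -normrM mulrBr [h * (_ *: _)]mulrA mulfV// mul1r.
    by rewrite mulrCA -expr2 real_normK ?num_real// [_ + theta]addrC.
  - exact: cvg_cst.
  - rewrite -[X in _ --> X](mulr0 k); apply: cvgMr.
    rewrite -[X in _ --> X](normr0 R); apply: cvg_norm.
    exact: nbhs_dnbhs.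
have intF : D.-integrable [set: Z]
    (EFin \o (fun z => l (theta + h *: delta_mx 0 i) z - l theta z)).
  exact: (integrableB _ (intl _) (intl _)).
have intH : D.-integrable [set: Z] (EFin \o (fun z => h * grad (l ^~ z) theta 0 i)).
  exact: (integrableZl _ h intG).
rewrite /risk -RintegralB// -RintegralZl// -RintegralB//.
apply: normr_Rintegral_le; first exact: (integrableB _ intF intH).
by move=> z; exact: grad_taylor (dl ^~ z) (lip z).
Unshelve. all: by end_near. Qed.

Lemma integrable_sumR {R : realType} {d} {Z : measurableType d} {m : nat}
    (D : probability Z R) (f : 'I_m -> Z -> R) :
  (forall i, D.-integrable [set: Z] (EFin \o f i)) ->
  D.-integrable [set: Z] (EFin \o (fun z => \sum_(i < m) f i z)).
Proof.
move=> intf; rewrite (_ : _ \o _ = fun z => (\sum_(i < m) (f i z)%:E)%E).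
  by apply: integrable_sum => // i _; exact: intf.
by apply/funext => z; rewrite /= -sumEFin.
Qed.

Lemma Rintegral_sum {R : realType} {d} {Z : measurableType d} {m : nat}
    (D : probability Z R) (f : 'I_m -> Z -> R) :
  (forall i, D.-integrable [set: Z] (EFin \o f i)) ->
  Rintegral D [set: Z] (fun z => \sum_(i < m) f i z) =
  \sum_(i < m) Rintegral D [set: Z] (f i).
Proof.
elim: m f => [|m IH] f intf.
  rewrite big_ord0 -[RHS](mul0r (fine (D setT))) -Rintegral_cst//.
  by apply: eq_Rintegral => z _; rewrite big_ord0.
rewrite big_ord_recr/= -IH// -RintegralD//; last exact: integrable_sumR.
by apply: eq_Rintegral => z _; rewrite big_ord_recr.
Qed.

(** To keep the constant k in the Euclidean norm, test the difference v of the gradients against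
    itself: |v|^2 is the mean of the inner products of v with the pointwise gradient differences,
    hence at most |v| k |x - y|. *)
Lemma elipschitz_grad_risk {R : realType} {m : nat} {d} {Z : measurableType d}
    (k : R) (l : 'rV[R]_m -> Z -> R) (D : probability Z R) : 0 <= k ->
  finite_risk l D ->
  (forall x z, differentiable (l ^~ z) x) ->
  (forall z, elipschitz k (grad (l ^~ z))) ->
  elipschitz k (grad (risk l D)).
Proof.
move=> k0 intl dl lip x y; set v := _ - _.
have intG u i := integrable_grad _ _ _ u i intl dl lip.
pose g z := grad (l ^~ z) x - grad (l ^~ z) y.
have intg i : D.-integrable [set: Z] (EFin \o (fun z => g z 0 i)).
  rewrite (_ : _ \o _ = EFin \o (fun z => grad (l ^~ z) x 0 i - grad (l ^~ z) y 0 i)).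
    exact: (integrableB _ (intG x i) (intG y i)).
  by apply/funext => z; rewrite /= /g !mxE.
have vE i : v 0 i = Rintegral D [set: Z] (fun z => g z 0 i).
  have -> : v 0 i = grad (risk l D) x 0 i - grad (risk l D) y 0 i by rewrite !mxE.
  rewrite !(grad_risk _ _ _ _ _ intl dl lip) -RintegralB//; try exact: intG.
  by apply: eq_Rintegral => z _; rewrite /g !mxE.
have [->|v0] := eqVneq (enorm v) 0; first by rewrite mulr_ge0// enorm_ge0.
have v_gt0 : 0 < enorm v by rewrite lt0r v0 enorm_ge0.
rewrite -(ler_pM2l v_gt0) -expr2 sqr_enorm.
have -> : \sum_(i < m) v 0 i ^+ 2 =
    Rintegral D [set: Z] (fun z => \sum_(i < m) v 0 i * g z 0 i).
  rewrite Rintegral_sum => [|i]; last exact: (integrableZl _ (v 0 i) (intg i)).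
  by apply: eq_bigr => i _; rewrite RintegralZl// -vE.
apply: (le_trans (ler_norm _)); apply: normr_Rintegral_le.
  by apply: integrable_sumR => i; exact: (integrableZl _ (v 0 i) (intg i)).
move=> z; rewrite (le_trans (normr_dot_le_enorm _ _))// ler_wpM2l ?enorm_ge0//.
exact: lip.
Qed.

(** * Cauchy-Schwarz for extended-real functions *)

(** For f >= 0 the condition 1/f > r reads r f < 1; this also holds where f = 0 and the inverse is
    [+oo]. *)
Lemma measurable_ereal_inv {R : realType} {d} {T : measurableType d} (f : T -> R) :
  measurable_fun [set: T] f -> (forall x, 0 <= f x) ->
  measurable_fun [set: T] (fun x => ((f x)%:E^-1)%E).
Proof.
move=> mf f0; apply: (measurability _ (ErealGenOInfty.measurableE R)).
move=> _ [_ [r ->] <-]; rewrite setTI.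
have -> : (fun x => (f x)%:E^-1)%E @^-1` `]r%:E, +oo[%classic =
    (fun x => r * f x) @^-1` `]-oo, 1[%classic.
  apply/seteqP; split => x /=; rewrite !in_itv/= andbT inver.
  - case: eqVneq => [-> _|fx0]; first by rewrite mulr0.
    by rewrite lte_fin -ltr_pdivlMr ?div1r// lt0r fx0 f0.
  - case: eqVneq => [-> _|fx0]; first by rewrite ltry.
    by rewrite lte_fin -ltr_pdivlMr ?div1r// lt0r fx0 f0.
rewrite -[_ @^-1` _]setTI; apply: (_ : measurable_fun setT (fun x => r * f x)) => //.
by apply: measurable_funM.
Qed.

(** Young's inequality with weight s: for real x and y it is (s x - y)^2 >= 0 divided by 2s, and if
    either is infinite the right-hand side is [+oo]. *)
Lemma mule_le_sqr {R : realType} (s : R) (x y : \bar R) : 0 < s ->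
  (0 <= x -> 0 <= y ->
    x * y <= (s / 2)%:E * x ^+ 2 + (s^-1 / 2)%:E * y ^+ 2)%E.
Proof.
move=> s0; have h1 : 0 < s / 2 by rewrite divr_gt0.
have h2 : 0 < s^-1 / 2 by rewrite divr_gt0// invr_gt0.
case: x => [x| |]//; last first.
  move=> _ y0; rewrite expe2 mulyy gt0_muley ?lte_fin// addye ?leey//.
  by rewrite gt_eqF// (lt_le_trans _ (mule_ge0 _ (sqre_ge0 _)))// ?ltNyr// lee_fin ltW.
case: y => [y| |]// x0 y0; last first.
  rewrite (expe2 +oo)%E mulyy (gt0_muley (x := (s^-1 / 2)%:E)) ?lte_fin// addey ?leey//.
rewrite -!EFin_expe -!EFinM -EFinD lee_fin.
have := sqr_ge0 (s * x - y); rewrite -(pmulr_rge0 _ h2) => h.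
rewrite -subr_ge0; apply: le_trans h _; rewrite le_eqVlt; apply/orP; left; apply/eqP.
by field; rewrite gt_eqF.
Qed.

Lemma le_sqrt_of_amgm {R : realType} (x c e : R) : 0 <= c -> 0 <= e ->
  (forall s, 0 < s -> x <= s / 2 * c + s^-1 / 2 * e) -> x <= Num.sqrt (c * e).
Proof.
move=> c0 e0 h; have [x0|x0] := leP x 0; first by rewrite (le_trans x0)// sqrtr_ge0.
rewrite -[x]gtr0_norm// -sqrtr_sqr ler_sqrt ?mulr_ge0//.
have [c00|c0'] := eqVneq c 0.
  (* For c = 0 this weight turns the hypothesis into x <= x e / (2 (e + 1)), impossible for x >
     0. *)
  have s0 : 0 < (e + 1) / x by rewrite divr_gt0//; lra.
  have := h _ s0; rewrite c00 mulr0 add0r invf_div.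
  have -> : x / (e + 1) / 2 * e = (x * e) / (2 * (e + 1)) by field; lra.
  by rewrite ler_pdivlMr; nra.
have cgt0 : 0 < c by rewrite lt0r c0'.
(* The weight s = x / c gives x <= x/2 + ce/(2x), that is x^2 <= ce. *)
have := h _ (divr_gt0 x0 cgt0); rewrite invf_div.
have -> : x / c / 2 * c + c / x / 2 * e = x / 2 + (c * e) / (2 * x).
  by field; rewrite !gt_eqF.
rewrite -lerBlDl ler_pdivlMr; last lra.
by rewrite (_ : (x - x / 2) * (2 * x) = x ^+ 2)//; field.
Qed.

(** Integrate Young's inequality for every weight s, then optimise over s by [le_sqrt_of_amgm]. *)
Lemma ge0_integral_mul_le_sqrt {R : realType} {d} {T : measurableType d}
    (mu : {measure set T -> \bar R}) (f g : T -> \bar R) :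
  measurable_fun [set: T] f -> measurable_fun [set: T] g ->
  (forall x, 0 <= f x)%E -> (forall x, 0 <= g x)%E ->
  (\int[mu]_x (f x ^+ 2) < +oo)%E -> (\int[mu]_x (g x ^+ 2) < +oo)%E ->
  (\int[mu]_x (f x * g x) <=
     sqrte ((\int[mu]_x (f x ^+ 2)) * (\int[mu]_x (g x ^+ 2))))%E.
Proof.
move=> mf mg f0 g0.
have c0 : (0 <= \int[mu]_x (f x ^+ 2))%E by apply: integral_ge0 => x _; exact: sqre_ge0.
have e0 : (0 <= \int[mu]_x (g x ^+ 2))%E by apply: integral_ge0 => x _; exact: sqre_ge0.
have mf2 : measurable_fun [set: T] (fun x => f x ^+ 2)%E.
  by under eq_fun do rewrite expe2; exact: emeasurable_funM.
have mg2 : measurable_fun [set: T] (fun x => g x ^+ 2)%E.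
  by under eq_fun do rewrite expe2; exact: emeasurable_funM.
have H s : 0 < s -> (\int[mu]_x (f x * g x) <=
    (s / 2)%:E * \int[mu]_x (f x ^+ 2) + (s^-1 / 2)%:E * \int[mu]_x (g x ^+ 2))%E.
  move=> s0; have h1 : (0 <= (s / 2)%:E)%E by rewrite lee_fin; lra.
  have h2 : (0 <= (s^-1 / 2)%:E)%E by rewrite lee_fin divr_ge0// invr_ge0 ltW.
  have F0 x : (0 <= (s / 2)%:E * f x ^+ 2)%E by rewrite mule_ge0// sqre_ge0.
  have G0 x : (0 <= (s^-1 / 2)%:E * g x ^+ 2)%E by rewrite mule_ge0// sqre_ge0.
  have mF : measurable_fun [set: T] (fun x => (s / 2)%:E * f x ^+ 2)%E.
    exact: measurable_funeM.
  have mG : measurable_fun [set: T] (fun x => (s^-1 / 2)%:E * g x ^+ 2)%E.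
    exact: measurable_funeM.
  rewrite -ge0_integralZl//; last by move=> x _; exact: sqre_ge0.
  rewrite -ge0_integralZl//; last by move=> x _; exact: sqre_ge0.
  rewrite -ge0_integralD//.
  apply: ge0_le_integral => //.
  - by move=> x _; rewrite mule_ge0.
  - exact: emeasurable_funM.
  - exact: emeasurable_funD.
  - by move=> x _; exact: mule_le_sqr.
have i0 : (0 <= \int[mu]_x (f x * g x))%E by apply: integral_ge0 => x _; exact: mule_ge0.
move: i0 c0 e0 H; set I := integral _ _ _.
set C := integral _ _ _; set D := integral _ _ _.
move: I C D => [x| |]// [c| |]// [e| |]// i0 c0 e0 H _ _.
  by rewrite -EFinM lee_fin; exact: le_sqrt_of_amgm.
(* An infinite integral of the product would contradict the finite bound at s = 1. *)
by have := H 1 ltr01; rewrite -!EFinM leye_eq.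
Qed.

(** * Measurability of the ball mass and of the pi-norm *)

(** The ball is a section of a measurable subset of the product space, and the measure of a section
    depends measurably on the base point. *)
Lemma measurable_pi_eball {R : realType} {m : nat} {d} {T : measurableType d}
    (pi : probability (borel_rV R m) R) (X : T -> 'rV[R]_m) (eps : R) :
  (forall i, measurable_fun [set: T] (fun t => X t 0 i)) ->
  measurable_fun [set: T] (fun t => pi (eball (X t) eps)).
Proof.
move=> mX.
pose A := [set p : T * borel_rV R m | enorm ((p.2 : 'rV[R]_m) - X p.1) < eps].
rewrite (_ : (fun t => _) = pi \o xsection A); last first.
  apply/funext => t /=; congr (pi _); apply/seteqP.
  by split=> x; rewrite /xsection/= inE.
apply: measurable_fun_xsection.
rewrite (_ : A = (fun p : T * borel_rV R m =>
    enorm ((p.2 : 'rV[R]_m) - X p.1)) @^-1` `]-oo, eps[%classic); last first.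
  by apply/seteqP; split => p; rewrite /A /= in_itv.
rewrite -[_ @^-1` _]setTI.
apply: (_ : measurable_fun setT _) => //.
apply: measurable_enorm => i.
rewrite (_ : (fun p => _) = (fun p : T * borel_rV R m =>
    (p.2 : 'rV[R]_m) 0 i - X p.1 0 i)); last first.
  by apply/funext => p; rewrite !mxE.
apply: measurable_funB.
  exact: (measurableT_comp (measurable_coord i) measurable_snd).
exact: (measurableT_comp (mX i) measurable_fst).
Qed.

(** Measurability in t and a uniform Lipschitz bound in x make [f t x] jointly measurable, so
    Tonelli applies to the inner integral. *)
Lemma measurable_norm_pi {R : realType} {m : nat} {d} {T : measurableType d}
    (pi : probability (borel_rV R m) R) (k : R) (f : T -> 'rV[R]_m -> 'rV[R]_m) :
  0 <= k -> (forall t, elipschitz k (f t)) ->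
  (forall x i, measurable_fun [set: T] (fun t => f t x 0 i)) ->
  measurable_fun [set: T] (fun t => norm_pi pi (f t)).
Proof.
move=> k0 lip mf.
rewrite /norm_pi; under eq_fun => t.
  rewrite -poweR12_sqrt; last by apply: integral_ge0 => x _; rewrite lee_fin sqr_ge0.
  over.
apply: (measurableT_comp (measurable_poweR _)).
apply: (@measurable_fun_fubini_tonelli_F _ _ _ _ _ pi
  (fun p : T * borel_rV R m => ((enorm (f p.1 p.2)) ^+ 2)%:E)).
  apply/measurable_EFinP; apply: measurable_funX; apply: measurable_enorm => i.
  apply: (measurable_lipschitz_comp k
    (fun (p : T * borel_rV R m) x => f p.1 x 0 i) snd) => //.
  - by move=> w x y; exact: elipschitz_coord.
  - by move=> x; exact: (measurableT_comp (mf x i) measurable_fst).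
  - by move=> j; exact: (measurableT_comp (measurable_coord j) measurable_snd).
by move=> p; rewrite lee_fin sqr_ge0.
Qed.

Lemma measurable_enorm_sqr_pi {R : realType} {m : nat} (k : R)
    (f : 'rV[R]_m -> 'rV[R]_m) :
  0 <= k -> elipschitz k f ->
  measurable_fun [set: borel_rV R m] (fun x => ((enorm (f x)) ^+ 2)%:E).
Proof.
move=> k0 lip; apply/measurable_EFinP; apply: measurable_funX.
apply: measurable_enorm => i.
apply: (measurable_lipschitz_comp k (fun (_ : borel_rV R m) x => f x 0 i) id) => //.
- by move=> w x y; exact: elipschitz_coord.
- by move=> j; exact: measurable_coord.
Qed.

(** * Gradient descent: zeros at the limit and measurability *)

(** The step length mu |g(u_t)| = |u_t - u_{t+1}| tends to 0 because the iterates converge, and the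
    Lipschitz bound passes this to the limit point. *)
Lemma gd_iter_limit_zero {R : realType} {m : nat} (k mu : R)
    (g : 'rV[R]_m -> 'rV[R]_m) (x0 x : 'rV[R]_m) : 0 < mu -> elipschitz k g ->
  gd_iter mu g x0 t @[t --> \oo] --> x -> enorm (g x) = 0.
Proof.
move=> mu0 lip cvgx; pose u := gd_iter mu g x0.
pose a t := enorm (u t - x).
have a0 : a t @[t --> \oo] --> (0 : R) by exact: cvg_enorm cvgx.
have a1 : a t.+1 @[t --> \oo] --> (0 : R) by rewrite (cvg_shiftS a).
apply/eqP; rewrite eq_le enorm_ge0 andbT -(pmulr_rle0 _ mu0).
have H : (1 + mu * k) * a t + a t.+1 @[t --> \oo] --> (0 : R).
  rewrite -[X in _ --> X](addr0 (0 : R)); apply: cvgD => //.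
  by rewrite -[X in _ --> X](mulr0 (1 + mu * k)); exact: cvgMr.
apply: (ler_cvg_to (cvg_cst (mu * enorm (g x)) : _ @ \oo --> _) H).
apply: nearW => t.
have h1 : enorm (g x) <= enorm (g (u t)) + k * a t.
  have := enorm_distD (g (u t)) (g x) 0; rewrite !subr0 => h.
  by rewrite (le_trans h)// addrC lerD2l enorm_distC lip.
have h2 : mu * enorm (g (u t)) <= a t + a t.+1.
  have := enorm_distD x (u t) (u t.+1); rewrite [enorm (x - _)]enorm_distC.
  suff -> : enorm (u t - u t.+1) = mu * enorm (g (u t)) by [].
  by rewrite /u /= opprB addrC subrK enormZ gtr0_norm.
have := ler_wpM2l (ltW mu0) h1; rewrite mulrDr => /le_trans; apply.
by rewrite mulrDl mul1r mulrA addrAC lerD2r.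
Qed.

Lemma measurable_gd_iter {R : realType} {m : nat} {d} {T : measurableType d}
    (k mu : R) (g : T -> 'rV[R]_m -> 'rV[R]_m) (x0 : 'rV[R]_m) (t : nat) i :
  0 <= k -> (forall S, elipschitz k (g S)) ->
  (forall x i, measurable_fun [set: T] (fun S => g S x 0 i)) ->
  measurable_fun [set: T] (fun S => gd_iter mu (g S) x0 t 0 i).
Proof.
move=> k0 lip mg; elim: t i => [|t IH] i /=; first exact: measurable_cst.
under eq_fun do rewrite !mxE.
apply: measurable_funB; first exact: IH.
apply: measurable_funM => //.
apply: (measurable_lipschitz_comp k (fun S x => g S x 0 i)) => //.
by move=> S x y; exact: elipschitz_coord.
Qed.

(** Makes [theta_hat] a random vector, so that the integrand of [C_eps] is measurable. *)
Lemma measurable_gd_limit {R : realType} {m : nat} {d} {T : measurableType d}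
    (k mu : R) (g : T -> 'rV[R]_m -> 'rV[R]_m) (x0 : 'rV[R]_m) (x : T -> 'rV[R]_m) i :
  0 <= k -> (forall S, elipschitz k (g S)) ->
  (forall x i, measurable_fun [set: T] (fun S => g S x 0 i)) ->
  (forall S, gd_iter mu (g S) x0 t @[t --> \oo] --> x S) ->
  measurable_fun [set: T] (fun S => x S 0 i).
Proof.
move=> k0 lip mg cvgx.
apply: (measurable_fun_cvg (fun t => measurable_gd_iter k mu g x0 t i k0 lip mg)).
move=> S _; apply: (cvg_comp _ (fun y : 'rV[R]_m => y 0 i) (cvgx S)).
exact: coord_continuous.
Qed.

(** * Convergence, local mass and Markov bounds *)

Lemma cvg_le_harmonic {R : realType} (u : nat -> R) (a e : R) :
  u t @[t --> \oo] --> a -> 0 < e ->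
  exists K, forall T, (0 < T)%N -> u T <= a + K / T%:R + e.
Proof.
move=> ua e0.
have /cvgrPdist_le/(_ _ e0)[N _ HN] := ua.
(* For T < N the factor N / T exceeds 1, so the term of index T alone covers |u T - a|; from N on,
   the slack [e] does. *)
exists (\sum_(t < N) `|u t - a| * N%:R) => T T0.
have T0' : 0 < T%:R :> R by rewrite ltr0n.
have s0 : 0 <= (\sum_(t < N) `|u t - a| * N%:R) / T%:R.
  by rewrite divr_ge0// sumr_ge0// => t _; rewrite mulr_ge0.
have [NT|TN] := leqP N T.
  have := HN T NT; rewrite /= ler_distlC => /andP[_]; lra.
have h : `|u T - a| <= (\sum_(t < N) `|u t - a| * N%:R) / T%:R.
  rewrite ler_pdivlMr// (bigD1 (Ordinal TN))//=.
  rewrite (@le_trans _ _ (`|u T - a| * N%:R))//.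
    by rewrite ler_wpM2l// ler_nat ltnW.
  by rewrite lerDl sumr_ge0// => t _; rewrite mulr_ge0.
have := le_trans (ler_norm _) h; lra.
Qed.

(** On the ball |f| is at least r = |f c| - k eps. If r > 0, integrating the squares over the ball
    gives a pi-norm of at least r sqrt(p), with p the mass of the ball. *)
Lemma enorm_le_inv_pi {R : realType} {m : nat} (pi : probability (borel_rV R m) R)
    (k eps : R) (f : 'rV[R]_m -> 'rV[R]_m) (c : 'rV[R]_m) :
  0 <= k -> 0 < eps -> elipschitz k f ->
  pi (eball c eps) != 0%E ->
  ((enorm (f c))%:E <= (pi (eball c eps))^-1 * norm_pi pi f + (k * eps)%:E)%E.
Proof.
move=> k0 eps0 lip p0.
have mB := measurable_eball c eps.
have pfin : pi (eball c eps) \is a fin_num by exact: fin_num_measure.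
set p := fine (pi (eball c eps)).
have pE : pi (eball c eps) = p%:E by rewrite fineK.
have pge0 : 0 <= p by rewrite fine_ge0.
have pn0 : p != 0 by move: p0; rewrite pE eqe.
have p1 : p <= 1 by rewrite -lee_fin -pE probability_le1.
have pgt0 : 0 < p by rewrite lt0r pn0.
set h := enorm (f c); pose r := h - k * eps.
rewrite -leeBlDr// -EFinB -/r pE inver (negbTE pn0).
have [r0|r0] := leP r 0.
  by rewrite (@le_trans _ _ 0%E)// ?lee_fin// mule_ge0 ?lee_fin ?invr_ge0 ?sqrte_ge0.
have I0 : (0 <= \int[pi]_theta ((enorm (f theta)) ^+ 2)%:E)%E.
  by apply: integral_ge0 => x _; rewrite lee_fin sqr_ge0.
have key : ((r ^+ 2 * p)%:E <= \int[pi]_theta ((enorm (f theta)) ^+ 2)%:E)%E.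
  have -> : (r ^+ 2 * p)%:E = (\int[pi]_(x in eball c eps) (r ^+ 2)%:E)%E.
    by rewrite integral_cst// EFinM; congr (_ * _)%E; exact: esym.
  have mf := measurable_enorm_sqr_pi k f k0 lip.
  apply: (@le_trans _ _ (\int[pi]_(x in eball c eps) ((enorm (f x)) ^+ 2)%:E)%E).
    apply: ge0_le_integral => //.
    - by move=> x _; rewrite lee_fin sqr_ge0.
    - exact: measurable_funS mf.
    - move=> x xc; rewrite lee_fin ler_pXn2r// ?nnegrE ?enorm_ge0 ?(ltW r0)//.
      rewrite /r lerBlDr /h; have := enorm_distD (f x) (f c) 0; rewrite !subr0 => H.
      rewrite (le_trans H)// addrC lerD2l enorm_distC (le_trans (lip _ _))//.
      by rewrite ler_wpM2l// ltW.
  apply: ge0_subset_integral => //.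
  by move=> x _; rewrite lee_fin sqr_ge0.
apply: (@le_trans _ _ ((p^-1)%:E * (r * p)%:E)%E).
  by rewrite -EFinM mulrC mulfK.
apply: lee_wpmul2l; first by rewrite lee_fin invr_ge0.
rewrite /norm_pi (le_trans _ (_ : sqrte (r ^+ 2 * p)%:E <= _)%E)//; last first.
  by rewrite lee_sqrt.
rewrite /= lee_fin -[leLHS]gtr0_norm ?mulr_gt0// -sqrtr_sqr.
rewrite ler_sqrt ?mulr_ge0 ?sqr_ge0 ?(ltW r0)//.
(* Here sqrt(p) is weakened to p, by p^2 <= p, to match the inverse mass that [C_eps] squares. *)
rewrite exprMn ler_wpM2l ?sqr_ge0// expr2 ler_piMl//.
Qed.

(** The good event avoids {ab + c >= s}, of probability at most delta by Markov, and a null set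
    containing {a = +oo}. The latter is removed because a product [+oo * 0] is 0 and would hide a
    ball of zero mass. *)
Lemma cauchy_schwarz_markov {R : realType} {d} {T : measurableType d} (P : probability T R)
    (a b : T -> \bar R) (c delta : R) :
  measurable_fun [set: T] a -> measurable_fun [set: T] b ->
  (forall x, 0 <= a x)%E -> (forall x, 0 <= b x)%E ->
  0 < c -> 0 < delta ->
  (\int[P]_x (a x ^+ 2) < +oo)%E -> (\int[P]_x (b x ^+ 2) < +oo)%E ->
  exists E : set T, [/\ measurable E, ((1 - delta)%:E <= P E)%E &
    forall x, E x -> (a x < +oo)%E /\
      (a x * b x + c%:E <= delta^-1%:E *
        (sqrte ((\int[P]_x (a x ^+ 2)) * (\int[P]_x (b x ^+ 2))) + c%:E))%E].
Proof.
move=> ma mb a0 b0 c0 delta0 Ca Cb.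
set M := sqrte _.
have Mfin : M \is a fin_num.
  rewrite sqrte_fin_num; last first.
    by rewrite mule_ge0// integral_ge0// => x _; exact: sqre_ge0.
  rewrite fin_numM// ge0_fin_numE// integral_ge0// => x _; exact: sqre_ge0.
have M0 : (0 <= M)%E by exact: sqrte_ge0.
have ma2 : measurable_fun [set: T] (fun x => a x ^+ 2)%E.
  by under eq_fun do rewrite expe2; exact: emeasurable_funM.
pose Y x := (a x * b x + c%:E)%E.
have Y0 x : (0 <= Y x)%E by rewrite adde_ge0 ?mule_ge0// lee_fin ltW.
have mY : measurable_fun [set: T] Y.
  by apply: emeasurable_funD => //; exact: emeasurable_funM.
have iY : (\int[P]_x Y x <= M + c%:E)%E.
  rewrite ge0_integralD//.
  - rewrite integral_cst// [X in (_ * X)%E](_ : _ = 1%E); last exact: probability_setT.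
    rewrite mule1 leeD2r//.
    exact: ge0_integral_mul_le_sqrt.
  - by move=> x _; exact: mule_ge0.
  - exact: emeasurable_funM.
  - by move=> x _; rewrite lee_fin ltW.
(* The Markov threshold: the bound on the mean of [Y] divided by delta. It is positive since c > 0,
   even if M = 0. *)
pose s := delta^-1 * (fine M + c).
have s0 : 0 < s by rewrite mulr_gt0 ?invr_gt0// ltr_wpDl// fine_ge0.
have sE : s%:E = (delta^-1%:E * (M + c%:E))%E by rewrite EFinM EFinD fineK.
pose G := [set x | (s%:E <= `|Y x|)%E].
have mG : measurable G.
  rewrite -[G]setTI; apply: emeasurable_fun_c_infty => //.
  exact: measurableT_comp.
have PG : (P G <= delta%:E)%E.
  have := @le_integral_comp_abse _ _ _ P _ measurableT Y s id (@measurable_id _ _ _)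
    (fun _ h => h) (fun _ _ _ _ h => h) mY s0.
  rewrite setTI => h; have {h} : (s%:E * P G <= M + c%:E)%E.
    apply: le_trans h _; apply: le_trans iY.
    by under eq_integral do rewrite gee0_abs//.
  rewrite -[P G]fineK ?fin_num_measure// -EFinM -[M]fineK// -EFinD !lee_fin.
  rewrite /s -mulrA -ler_pdivlMl ?invr_gt0// invrK mulrC.
  by rewrite ler_pM2r// ltr_wpDl// fine_ge0.
have [N [mN N0 subN]] : P.-negligible [set x | a x = +oo%E].
  have : P.-integrable [set: T] (fun x => a x ^+ 2)%E.
    apply/integrableP; split => //.
    by under eq_integral do rewrite gee0_abs ?sqre_ge0//.
  move=> /(integrable_ae measurableT); apply: negligibleS => x /= ax h.
  by have := h I; rewrite ax mulyy.
exists (~` (G `|` N)); split.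
- by apply: measurableC; exact: measurableU.
- rewrite probability_setC; last exact: measurableU.
  have PN : P N = 0%E by exact: N0.
  have PU : (P (G `|` N) <= P G + P N)%E by exact: measureU2.
  by rewrite EFinB leeB// (le_trans PU)// PN adde0.
- move=> x /not_orP[Gx Nx]; split.
    rewrite ltey; apply/eqP => ax; exact/Nx/subN.
  move: Gx => /negP; rewrite -ltNge gee0_abs// => /ltW.
  by rewrite sE.
Qed.

(* K is the implied constant of the O(eps) inside the square, K2 that of the
   last O(eps), K1 that of O(1/T). *)
Theorem theorem3p3 (R : realType) (gamma : R) (gamma_gt0 : 0 < gamma) :
  exists2 K : R, 0 <= K &
  forall (m n N : nat) (d : measure_display) (Z : measurableType d)
    (l : 'rV[R]_m -> Z -> R)
    (DS : 'I_N -> probability Z R) (DT : probability Z R)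
    (P : probability (n.-tuple Z) R)
    (pi : probability (borel_rV R m) R)
    (Aggr : ('I_N -> 'rV[R]_m) -> 'rV[R]_m -> 'rV[R]_m)
    (mu delta : R),
  (0 < n)%N ->
  (forall theta z, 0 <= l theta z) ->
  (forall theta z, differentiable (l ^~ z) theta) ->
  (forall i, finite_risk l (DS i)) ->
  finite_risk l DT ->
  iid_law DT P ->
  (* for every theta, the aggregated gradient is a random vector *)
  (forall theta i,
    measurable_fun [set: n.-tuple Z]
      (fun S => aggr_grad l DS Aggr S theta 0 i)) ->
  (forall z, elipschitz (gamma / 2) (grad (l ^~ z))) ->
  (forall S : n.-tuple Z,
    elipschitz (gamma / 2) (aggr_grad l DS Aggr S)) ->
  0 < mu -> mu <= gamma^-1 ->
  0 < delta ->
  exists2 eps0 : R, 0 < eps0 &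
  exists K2 : n.-tuple Z -> R,
  forall (theta0 : 'rV[R]_m) (theta_hat : n.-tuple Z -> 'rV[R]_m),
  (forall S : n.-tuple Z,
    gd_iter mu (aggr_grad l DS Aggr S) theta0 t @[t --> \oo]
      --> theta_hat S) ->
  exists K1 : R -> n.-tuple Z -> R,
  forall eps : R, 0 < eps -> eps < eps0 ->
    (C_eps pi P theta_hat eps < +oo)%E ->
    exists E : set (n.-tuple Z),
      [/\ measurable E,
          ((1 - delta)%:E <= P E)%E &
          forall S, E S -> forall T : nat, (0 < T)%N ->
            (((enorm (grad (risk l DT)
                 (gd_iter mu (aggr_grad l DS Aggr S) theta0 T))) ^+ 2)%:E
             <= ((delta ^+ 2)^-1)%:E
                  * (sqrte (C_eps pi P theta_hat eps
                            * delta_error2 pi P (grad (risk l DT))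
                                (aggr_grad l DS Aggr))
                     + (K * eps)%:E) ^+ 2
                + (K1 eps S / T%:R)%:E + (K2 S * eps)%:E)%E].
Proof.
(* The error field is a difference of two gamma/2-Lipschitz maps, hence gamma-Lipschitz, and varies
   by at most gamma eps on the ball. *)
exists gamma; first exact: ltW.
move=> m n N d Z l DS DT P pi Aggr mu delta n0 l0 dl intS intT iid mghat lipl lipg
  mu0 mule delta0.
set gD := grad (risk l DT); set ghat := aggr_grad l DS Aggr.
have g20 : 0 <= gamma / 2 by lra.
have lipD : elipschitz (gamma / 2) gD by exact: elipschitz_grad_risk.
have mg x i : measurable_fun [set: n.-tuple Z] (fun S => ghat S x 0 i) by exact: mghat.
pose f S x := gD x - ghat S x.
have lipf S : elipschitz gamma (f S).
  move=> x y; have -> : f S x - f S y = (gD x - gD y) - (ghat S x - ghat S y).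
    by rewrite /f !opprB addrACA [RHS]addrACA [- ghat S x + _]addrC.
  rewrite (le_trans (ler_enormD _ _))// enormN.
  rewrite (le_trans (lerD (lipD x y) (lipg S x y)))//.
  by rewrite -mulrDl -splitr.
(* The threshold [eps0] = 1 is an arbitrary choice; [K2] = 1 is the coefficient of the slack eps in
   [cvg_le_harmonic]. *)
exists 1 => //; exists (fun=> 1) => theta0 theta_hat cvgth.
have mth i : measurable_fun [set: n.-tuple Z] (fun S => theta_hat S 0 i).
  exact: (measurable_gd_limit _ _ _ _ _ i g20 lipg mghat cvgth).
have cvgD S : enorm (gD (gd_iter mu (ghat S) theta0 t)) ^+ 2 @[t --> \oo]
    --> enorm (gD (theta_hat S)) ^+ 2.
  have h : enorm (gD (gd_iter mu (ghat S) theta0 t)) @[t --> \oo]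
      --> enorm (gD (theta_hat S)).
    apply/subr_cvg0/norm_cvg0P.
    apply: (@squeeze_cvgr _ _ _ _ (fun=> 0)
      (fun t => gamma / 2 * enorm (gd_iter mu (ghat S) theta0 t - theta_hat S))).
    - apply: nearW => t; rewrite normr_ge0/= (le_trans _ (lipD _ _))//.
      exact: ler_dist_enorm.
    - exact: cvg_cst.
    - rewrite -[X in _ --> X](mulr0 (gamma / 2)); apply: cvgMr.
      exact: cvg_enorm (cvgth S).
  by under eq_cvg do rewrite expr2; rewrite expr2; exact: cvgM.
(* [K1] must be fixed before eps, so the constants are chosen for all pairs (eps, S) at once, with a
   dummy 0 for eps <= 0. *)
have /choice[K1 K1P] : forall p : R * n.-tuple Z, exists K, 0 < p.1 ->
    forall T, (0 < T)%N -> enorm (gD (gd_iter mu (ghat p.2) theta0 T)) ^+ 2 <=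
      enorm (gD (theta_hat p.2)) ^+ 2 + K / T%:R + p.1.
  move=> [e S] /=; have [e0|e0] := ltP 0 e; last by exists 0.
  by have [K HK] := cvg_le_harmonic _ _ _ (cvgD S) e0; exists K.
exists (fun e S => K1 (e, S)) => eps eps0 _ Coo.
pose a S := ((pi (eball (theta_hat S) eps))^-1)%E.
pose b S := norm_pi pi (f S).
have pfin S : pi (eball (theta_hat S) eps) \is a fin_num.
  by apply: fin_num_measure; exact: measurable_eball.
have a1 S : (1 <= a S)%E.
  have p0 : 0 <= fine (pi (eball (theta_hat S) eps)) by rewrite fine_ge0.
  have p1 : fine (pi (eball (theta_hat S) eps)) <= 1.
    by rewrite -lee_fin fineK// probability_le1//; exact: measurable_eball.
  rewrite /a -(fineK (pfin S)) inver.
  case: eqVneq => [_|pn0]; first exact: leey.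
  by rewrite lee_fin invf_ge1// lt0r pn0.
have a0 S : (0 <= a S)%E by rewrite (le_trans _ (a1 S)).
have b0 S : (0 <= b S)%E by exact: sqrte_ge0.
have ma : measurable_fun [set: n.-tuple Z] a.
  have -> : a = (fun S => (fine (pi (eball (theta_hat S) eps)))%:E^-1)%E.
    by apply/funext => S; rewrite fineK.
  apply: measurable_ereal_inv => [|S]; last by rewrite fine_ge0.
  apply: measurableT_comp => //; exact: measurable_pi_eball.
have mgf x i : measurable_fun [set: n.-tuple Z] (fun S => f S x 0 i).
  under eq_fun do rewrite !mxE.
  by apply: measurable_funB => //; exact: mg.
have mb : measurable_fun [set: n.-tuple Z] b.
  exact: (measurable_norm_pi pi _ f (ltW gamma_gt0) lipf mgf).
have -> : C_eps pi P theta_hat eps = (\int[P]_S (a S ^+ 2))%E by [].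
have -> : delta_error2 pi P gD ghat = (\int[P]_S (b S ^+ 2))%E by [].
(* Ensures that an infinite Delta error times [C_eps] is [+oo] and not 0. *)
have C1 : (1 <= \int[P]_S (a S ^+ 2))%E.
  have <- : (\int[P]_S cst 1 S = 1)%E.
    by rewrite integral_cst// mul1e; exact: probability_setT.
  apply: ge0_le_integral => //.
  - by under eq_fun do rewrite expe2; exact: emeasurable_funM.
  - move=> S _; rewrite expe2 -[X in (X <= _)%E](mule1 1%E).
    exact: lee_pmul.
(* With infinite Delta error the right-hand side is [+oo], and the whole space serves as the
   event. *)
have [Doo|Doo] := eqVneq (\int[P]_S (b S ^+ 2))%E +oo%E.
  exists setT; split => // [|S _ T T0].
    by rewrite probability_setT lee_fin gerBl ltW.
  rewrite Doo gt0_muley ?(lt_le_trans _ C1)//=.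
  by rewrite addye// mulyy gt0_muley ?lte_fin ?invr_gt0 ?exprn_gt0// !addye ?leey.
have Doo' : (\int[P]_S (b S ^+ 2) < +oo)%E by rewrite ltey.
have [E [mE PE EP]] := cauchy_schwarz_markov P a b (gamma * eps) delta ma mb a0 b0
  (mulr_gt0 gamma_gt0 eps0) delta0 Coo Doo'.
exists E; split=> // S ES T T0; have [aSoo] := EP S ES.
set M := sqrte _ => abS.
have Mfin : M \is a fin_num.
  rewrite sqrte_fin_num; last first.
    by rewrite mule_ge0// integral_ge0// => x _; exact: sqre_ge0.
  by rewrite fin_numM// ge0_fin_numE// integral_ge0// => x _; exact: sqre_ge0.
have pn0 : pi (eball (theta_hat S) eps) != 0%E by rewrite -inve_eqy -ltey.
have ghat0 := gd_iter_limit_zero _ _ _ _ _ mu0 (lipg S) (cvgth S).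
(* Since [ghat S] vanishes at [theta_hat S], the error field there controls the target gradient. *)
have hf : enorm (gD (theta_hat S)) <= enorm (f S (theta_hat S)).
  have := ler_enormD (f S (theta_hat S)) (ghat S (theta_hat S)).
  by rewrite /f subrK /ghat ghat0 addr0.
have := le_trans (enorm_le_inv_pi pi _ _ _ _ (ltW gamma_gt0) eps0 (lipf S) pn0) abS.
rewrite -(fineK Mfin) -EFinD -EFinM lee_fin => /(le_trans hf) hM.
rewrite -EFin_expe -EFinM -!EFinD lee_fin mul1r.
apply: le_trans (K1P (eps, S) eps0 T T0) _; rewrite /= !lerD2r.
(* Squaring the Markov bound turns its factor 1/delta into 1/delta^2. *)
by rewrite -exprVn -exprMn ler_pXn2r// nnegrE ?(le_trans _ hM) ?enorm_ge0.
Qed.
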